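(* Let $r\ge 3$ be an integer, let $\varepsilon>0$, and let $G$ be an $n$-vertex $K_r$-free graph. Suppose that for every pair of non-adjacent vertices $u,v\in V(G)$, the induced subgraph $G[N(u)\cap N(v)]$ contains at least $\varepsilon n^{r-2}$ copies of $K_{r-2}$. Then $\chi(G)\le C$, where $C=C(r,\varepsilon)$ depends only on $r$ and $\varepsilon$ (and not on $n$ or $G$).
   Context: $N(u)$ denotes the set of neighbors of $u$ in $G$; $\chi(G)$ is the chromatic number of $G$. *)

(* Defs.v *)
From mathcomp Require Import all_boot all_order all_algebra.
From mathcomp Require Import reals.
Set Implicit Arguments. Unset Strict Implicit. Unset Printing Implicit Defensive.

(* A simple graph on a finite vertex type T is a symmetric irreflexive
   relation e : rel T.  The vertex count n is #|T|. *)

Definition nbhd (T : finType) (e : rel T) (u : T) : {set T} := [set v | e u v].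

Definition is_clique (T : finType) (e : rel T) (S : {set T}) : bool :=
  [forall x in S, forall y in S, (x != y) ==> e x y].

Definition num_Kk_in (T : finType) (e : rel T) (k : nat) (A : {set T}) : nat :=
  #|[set S : {set T} | [&& S \subset A, #|S| == k & is_clique e S]]|.

Definition Kr_free (T : finType) (e : rel T) (r : nat) : Prop :=
  forall S : {set T}, #|S| = r -> ~~ is_clique e S.

Definition colourable (T : finType) (e : rel T) (k : nat) : Prop :=
  exists f : T -> 'I_k, forall x y, e x y -> f x != f y.

(* Main.v *)
(* Let F(u) be the set of copies of K_{r-2} inside N(u). Adjacent u, v have
   F(u), F(v) disjoint, as G is K_r-free; non-adjacent ones share at least
   eps n^(r-2) copies. Conversely, if N(u) \ N(v) has fewer than eps n elements
   and u has a non-neighbour, then F(u), F(v) are not disjoint, so u, v are not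
   adjacent. It is thus enough to bound the size of a set A of vertices whose
   neighbourhoods pairwise differ in at least d n elements, and to colour each
   vertex by a close member of a maximal such A (the universal vertices form a
   clique, hence fewer than r colours suffice for them).
   Greedily pick m copies of K_{r-2} such that all but a (1 - eps)^m proportion
   of the non-adjacent pairs (u, w), u in A, have one of the picked copies in
   F(u) and F(w). For at least half of the u in A, the picked copies lying in
   F(u) determine N(u) up to d n vertices; hence |A| <= 2 * 2^m. *)
Require Import Defs.
From mathcomp Require Import all_boot all_order all_algebra.
From mathcomp Require Import reals.
From mathcomp Require Import ring lra zify.
Set Implicit Arguments. Unset Strict Implicit. Unset Printing Implicit Defensive.
Import Order.TTheory GRing.Theory Num.Theory.
Local Open Scope ring_scope.

(** * Decay of the powers of [1 - x] *)

Lemma bernoulli_expr (R : realType) (x : R) (m : nat) :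
  0 <= x -> x <= 1 -> (1 - x) ^+ m * (1 + m%:R * x) <= 1.
Proof.
move=> x0 x1; elim: m => [|m IH]; first by rewrite expr0; lra.
apply: le_trans IH; rewrite exprSr -mulrA ler_wpM2l ?exprn_ge0 ?subr_ge0 //.
have m0 : 0 <= m%:R :> R by apply: ler0n.
have : 0 <= m%:R * x * x by rewrite !mulr_ge0.
by rewrite -natr1; nra.
Qed.

Lemma exists_expr_le (R : realType) (x y : R) :
  0 < x -> x <= 1 -> 0 < y -> exists m : nat, (1 - x) ^+ m <= y.
Proof.
move=> x0 x1 y0; pose m := Num.Def.archi_bound (x * y)^-1.
have xy0 : 0 < x * y by rewrite mulr_gt0.
have hm : (x * y)^-1 < m%:R by apply: archi_boundP; rewrite invr_ge0 ltW.
have hm1 : 1 < m%:R * (x * y) by rewrite -ltr_pdivrMr // div1r.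
exists m; have hb := @bernoulli_expr R x m (ltW x0) x1.
have p0 : 0 <= (1 - x) ^+ m by rewrite exprn_ge0 // subr_ge0.
rewrite leNgt; apply/negP => hlt.
have m0 : 0 <= m%:R :> R by apply: ler0n.
have mx0 : 0 <= m%:R * x by rewrite mulr_ge0 // ltW.
have : y * (m%:R * x) <= (1 - x) ^+ m * (m%:R * x) by rewrite ler_wpM2r // ltW.
nra.
Qed.

(** * Double counting and greedy hitting sets *)

Lemma sum_card_slices (P O : finType) (B : {set P}) (W : {set O}) (h : P -> O -> bool) :
  (\sum_(q in W) #|[set p in B | h p q]| = \sum_(p in B) #|[set q in W | h p q]|)%N.
Proof.
under eq_bigr => q _ do rewrite -sum1_card.
under [RHS]eq_bigr => p _ do rewrite -sum1_card.
rewrite (exchange_big_dep (mem B)) /=; last by move=> q p _; rewrite inE => /andP[].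
by apply: eq_bigr => p pB; apply: eq_bigl => q; rewrite !inE pB.
Qed.

(** By averaging, some [q] lies in [H p] for at least a proportion [eps] of the [p] in [B]. Picking
    it leaves at most [(1 - eps) * #|B|] elements unhit, and the induction continues with these. *)
Lemma greedy_hitting (R : realType) (P O : finType) (W : {set O}) (M : nat)
    (H : P -> {set O}) (eps : R) (m : nat) (B : {set P}) :
  0 < eps -> eps <= 1 -> (#|W| <= M)%N -> (0 < M)%N ->
  (forall p, p \in B -> H p \subset W /\ eps * M%:R <= #|H p|%:R) ->
  exists2 s : seq O, (size s <= m)%N &
    #|[set p in B | all (fun q => q \notin H p) s]|%:R <= (1 - eps) ^+ m * #|B|%:R.
Proof.
move=> e0 e1 WM M0; elim: m B => [|m IH] B HB.
  exists [::] => //; rewrite expr0 mul1r ler_nat subset_leq_card //.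
  by apply/subsetP => p; rewrite inE => /andP[].
have p0 k : 0 <= (1 - eps) ^+ k by rewrite exprn_ge0 // subr_ge0.
have [B0|[p1 p1B]] := set_0Vmem B.
  exists [::] => //; rewrite B0 cards0 mulr0 lern0 cards_eq0.
  by apply/eqP/setP => p; rewrite !inE.
have MR : 0 < M%:R :> R by rewrite ltr0n.
have [q qW hq] : exists2 q, q \in W & eps * #|B|%:R <= #|[set p in B | q \in H p]|%:R.
  apply/exists_inP; apply: contraT; rewrite negb_exists_in => /forall_inP hq.
  have W0 : (0 < #|W|)%N.
    have [sW le] := HB _ p1B; apply: leq_trans (subset_leq_card sW).
    by rewrite -(ltr_nat R); apply: lt_le_trans le; rewrite mulr_gt0.
  have /card_gt0P[q0 q0W] := W0.
  have := sum_card_slices B W (fun p q => q \in H p).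
  move=> /(congr1 (fun k => k%:R : R)); rewrite !natr_sum => eqs.
  have : \sum_(q in W) (#|[set p in B | q \in H p]|%:R : R) < \sum_(q in W) (eps * #|B|%:R).
    apply: ltr_sum => [|q qW]; last by rewrite ltNge hq.
    by apply/hasP; exists q0; rewrite ?mem_index_enum.
  rewrite eqs ltNge => /negP[].
  apply: (@le_trans _ _ (\sum_(p in B) (eps * M%:R))).
    rewrite !sumr_const -[X in X <= _]mulr_natr -[X in _ <= X]mulr_natr mulrAC.
    by rewrite ler_wpM2r // ler_wpM2l ?ler_nat // ltW.
  apply: ler_sum => p pB; have [sW le] := HB _ pB; apply: le_trans le _.
  rewrite ler_nat subset_leq_card //; apply/subsetP => q qH.
  by rewrite inE qH (subsetP sW).
pose B1 := [set p in B | q \notin H p].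
have [p|s sm hs] := IH B1; first by rewrite inE => /andP[pB _]; apply: HB.
exists (q :: s) => //=.
have -> : [set p in B | (q \notin H p) && all (fun q => q \notin H p) s] =
          [set p in B1 | all (fun q => q \notin H p) s].
  by apply/setP => p; rewrite !inE andbA.
apply: le_trans hs _; rewrite exprSr -mulrA ler_wpM2l // mulrBl mul1r.
have cardB : #|B| = (#|[set p in B | q \in H p]| + #|B1|)%N.
  rewrite -(cardsID [set p | q \in H p] B); congr (_ + _)%N; apply: eq_card => p.
    by rewrite !inE.
  by rewrite !inE andbC.
by move: hq; rewrite cardB natrD; lra.
Qed.

(** * Vertices with pairwise distant neighbourhoods *)

Definition gap (T : finType) (e : rel T) (u v : T) : nat := #|nbhd e u :\: nbhd e v|.

Lemma card_separated_le (R : realType) (T O : finType) (e : rel T) (F : T -> {set O})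
    (W : {set O}) (M m : nat) (eps d : R) (A : {set T}) :
  0 < eps -> eps <= 1 -> 0 < d -> (1 - eps) ^+ m * 2 <= d ->
  (#|W| <= M)%N -> (0 < M)%N -> (forall u, F u \subset W) ->
  (forall u w, e u w -> F u :&: F w = set0) ->
  (forall u w, u \in A -> ~~ e u w -> eps * M%:R <= #|F u :&: F w|%:R) ->
  {in A &, forall u v, (gap e u v)%:R <= d * #|T|%:R -> (gap e v u)%:R <= d * #|T|%:R -> u = v} ->
  (#|A| <= 2 ^ m.+1)%N.
Proof.
move=> e0 e1 d0 hm WM M0 FW Fdisj Fbig sep.
pose B := [set p : T * T | (p.1 \in A) && ~~ e p.1 p.2].
have [[u w]|s sm hs] := @greedy_hitting R _ O W M (fun p => F p.1 :&: F p.2) eps m B e0 e1 WM M0.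
  rewrite inE /= => /andP[uA euw]; split; last exact: Fbig.
  by rewrite subIset // FW.
pose missed u w := ~~ e u w && all (fun q => q \notin F u :&: F w) s.
pose D u := [set w | missed u w].
pose n : R := #|T|%:R.
(* The average of [#|D u|] over [A] is at most [(1 - eps) ^+ m * n <= d * n / 2], so at most half of
   [A] is bad. *)
pose bad := [set u in A | d * n < #|D u|%:R].
have sumD : \sum_(u in A) (#|D u|%:R : R) <= (1 - eps) ^+ m * (#|A|%:R * n).
  apply: le_trans (le_trans hs _).
    rewrite -natr_sum ler_nat -sum1_card.
    under eq_bigr => u _ do rewrite -sum1_card.
    rewrite pair_big_dep /=; apply: eq_leq; apply: eq_bigl => -[u w].
    by rewrite !inE /= andbA.
  rewrite ler_wpM2l ?exprn_ge0 ?subr_ge0 // -natrM ler_nat.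
  rewrite -cardsT -cardsX subset_leq_card //.
  by apply/subsetP => -[u w]; rewrite !inE /= => /andP[->].
have badA : bad \subset A by apply/subsetP => u; rewrite inE => /andP[].
have [A0|[a aA]] := set_0Vmem A; first by rewrite A0 cards0.
have n0 : 0 < n by rewrite ltr0n; apply/card_gt0P; exists a.
have bad_half : (2 * #|bad| <= #|A|)%N.
  rewrite -(ler_nat R) natrM.
  have : #|bad|%:R * (d * n) <= (1 - eps) ^+ m * (#|A|%:R * n).
    apply: le_trans sumD; rewrite mulr_natl -sumr_const.
    rewrite [X in _ <= X](big_setID bad) /= (setIidPr badA).
    rewrite -[X in X <= _]addr0 lerD ?sumr_ge0 //.
    by apply: ler_sum => u; rewrite inE => /andP[_ /ltW].
  rewrite !mulrA ler_pM2r // => hle.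
  have : (1 - eps) ^+ m * 2 * #|A|%:R <= d * #|A|%:R by rewrite ler_wpM2r.
  by rewrite -(ler_pM2l d0); lra.
pose trace u := [set q in F u | q \in s].
(* If [w] in N(u) \ N(v) were not missed by [v], some [q] of [s] would lie in [F v] and [F w]. Equal
   traces put [q] in [F u], against the disjointness of [F u] and [F w]. So N(u) \ N(v) is contained
   in [D v]. *)
have trace_gap u v : v \in A :\: bad -> trace u = trace v -> (gap e u v)%:R <= d * n.
  rewrite !inE => /andP[vbad vA]; move: vbad; rewrite vA /= -leNgt => Dv tr.
  apply: le_trans Dv; rewrite ler_nat subset_leq_card //; apply/subsetP => w.
  rewrite !inE /missed => /andP[-> euw]; apply/allP => q qs.
  have := Fdisj _ _ euw; apply: contra_eqN; rewrite inE => /andP[qv qw].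
  have : q \in trace u by rewrite tr inE qv.
  by rewrite inE => /andP[qu _]; apply/set0Pn; exists q; rewrite inE qu.
have good_le : (#|A :\: bad| <= 2 ^ m)%N.
  have inj : {in A :\: bad &, injective trace}.
    move=> u v ug vg tr; apply: sep; rewrite ?trace_gap //.
      by move: ug; rewrite inE => /andP[].
    by move: vg; rewrite inE => /andP[].
  rewrite -(card_in_imset inj).
  apply: leq_trans (_ : #|powerset [set q in s]| <= _)%N.
    apply/subset_leq_card/subsetP => _ /imsetP[u _ ->].
    by rewrite inE; apply/subsetP => q; rewrite !inE => /andP[].
  rewrite card_powerset leq_exp2l // cardsE.
  exact: leq_trans (card_size s) sm.
rewrite cardsD (setIidPr badA) in good_le.
by rewrite expnS; lia.
Qed.

(** * Nets and colourings *)

Lemma exists_close_net (T : finType) (close : rel T) (V : {set T}) :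
  reflexive close ->
  exists A : {set T}, [/\ A \subset V,
    {in A &, forall u v, close u v -> close v u -> u = v} &
    forall u, u \in V -> exists2 a, a \in A & close u a && close a u].
Proof.
move=> crefl.
pose sep (A : {set T}) := (A \subset V) &&
  [forall u in A, forall v in A, close u v && close v u ==> (u == v)].
have [|A /maxsetP[/andP[AV /forall_inP sA] maxA]] := @ex_maxset _ sep.
  by exists set0; rewrite /sep sub0set; apply/forall_inP => u; rewrite inE.
have {}sA : {in A &, forall u v, close u v -> close v u -> u = v}.
  move=> u v uA vA uv vu; have /forall_inP/(_ v vA) := sA u uA.
  by rewrite uv vu => /eqP.
exists A; split=> // u uV; apply/exists_inP; apply: contraT.
rewrite negb_exists_in => /forall_inP far.
(* A vertex far from all of [A] could be added to [A], so by maximality it is already there, and it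
   is close to itself. *)
have uA : u \in A.
  rewrite -(maxA (u |: A)) ?setU11 ?subsetUr // /sep subUset sub1set uV AV /=.
  apply/forall_inP => x xA; apply/forall_inP => y yA; apply/implyP => /andP[xy yx].
  move: xA yA; rewrite !inE => /predU1P[ex|xA] /predU1P[ey|yA].
  - by rewrite ex ey.
  - by have := far _ yA; rewrite -ex xy yx.
  - by have := far _ xA; rewrite -ey xy yx.
  - by apply/eqP/sA.
by have := far _ uA; rewrite crefl.
Qed.

Lemma colourable_by_map (T : finType) (e : rel T) (A : {set T}) (g : T -> T) (C : nat) :
  (forall u, g u \in A) -> (#|A| <= C)%N -> (forall u v, e u v -> g u != g v) ->
  colourable e C.
Proof.
move=> gA AC ge.
exists (fun u => widen_ord AC (enum_rank_in (gA u) (g u))) => u v euv.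
apply: contra (ge _ _ euv) => /eqP/(congr1 val) /= eqr.
apply/eqP; rewrite -(enum_rankK_in (gA u) (gA u)) -(enum_rankK_in (gA v) (gA v)).
rewrite !(enum_val_nth (g u)).
by rewrite eqr.
Qed.

(** * Counting cliques *)

Lemma bin_le_expn (n k : nat) : ('C(n, k) <= n ^ k)%N.
Proof.
apply: (@leq_trans (n ^_ k)); first by rewrite -bin_ffact leq_pmulr ?fact_gt0.
elim: k => // k IH; by rewrite ffactnSr expnSr leq_mul ?leq_subr.
Qed.

(** The set whose cardinal is [num_Kk_in], kept as a set so that families of copies can be
    intersected and subtracted. *)
Definition cliques_in (T : finType) (e : rel T) (k : nat) (A : {set T}) : {set {set T}} :=
  [set S : {set T} | [&& S \subset A, #|S| == k & is_clique e S]].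

Lemma cliques_inI (T : finType) (e : rel T) (k : nat) (A B : {set T}) :
  cliques_in e k A :&: cliques_in e k B = cliques_in e k (A :&: B).
Proof.
by apply/setP => S; rewrite !inE subsetI; do !case: (_ \subset _); rewrite ?andbb ?andbF.
Qed.

Lemma is_cliqueU1 (T : finType) (e : rel T) (u : T) (S : {set T}) :
  symmetric e -> is_clique e S -> S \subset nbhd e u -> is_clique e (u |: S).
Proof.
move=> es /forall_inP cS /subsetP Su.
have Se v : v \in S -> e u v by move=> /Su; rewrite inE.
apply/forall_inP => x; rewrite !inE => /predU1P[->|xS];
  apply/forall_inP => y; rewrite !inE => /predU1P[->|yS]; apply/implyP => xy.
- by rewrite eqxx in xy.
- exact: Se.
- by rewrite es Se.
- by have /forall_inP/(_ y yS)/implyP := cS x xS; apply.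
Qed.

Lemma cliques_in_adjacent (T : finType) (e : rel T) (k : nat) (u v : T) :
  symmetric e -> irreflexive e -> Kr_free e k.+2 -> e u v ->
  cliques_in e k (nbhd e u) :&: cliques_in e k (nbhd e v) = set0.
Proof.
move=> es ei fr euv; apply/setP => S; rewrite !inE; apply/negP.
move=> /andP[/and3P[Su /eqP Sk Sc] /and3P[Sv _ _]].
have vS : v \notin S by apply/negP => /(subsetP Sv); rewrite inE ei.
have uS : u \notin v |: S.
  rewrite !inE negb_or; apply/andP; split.
    by apply: contraTneq euv => ->; rewrite ei.
  by apply/negP => /(subsetP Su); rewrite inE ei.
have cardS : #|u |: (v |: S)| = k.+2 by rewrite !cardsU1 uS vS Sk.
move/negP: (fr _ cardS); apply; apply: is_cliqueU1 => //; first exact: is_cliqueU1.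
by rewrite subUset sub1set inE euv.
Qed.

(** A clique inside [A] but not inside [B] has a vertex [x] in [A :\: B], and is determined by [x]
    and its other [k] vertices. *)
Lemma card_cliques_diff (T : finType) (e : rel T) (k : nat) (A B : {set T}) :
  (#|cliques_in e k.+1 A :\: cliques_in e k.+1 B| <= #|A :\: B| * #|T| ^ k)%N.
Proof.
pose W := [set S : {set T} | #|S| == k].
have cW : (#|W| <= #|T| ^ k)%N by rewrite card_draws bin_le_expn.
apply: (@leq_trans (#|[set x |: S | x in A :\: B, S in W]|)).
  apply/subset_leq_card/subsetP => S; rewrite !inE => /andP[SB /and3P[SA Sk Sc]].
  move: SB; rewrite Sk Sc !andbT => /subsetPn[x xS xB].
  apply/imset2P; exists x (S :\ x); rewrite ?setD1K // !inE ?xB ?(subsetP SA) //.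
  by move: Sk; rewrite (cardsD1 x) xS.
apply: leq_trans (leq_mul (leqnn _) cW); rewrite -cardsX.
by rewrite curry_imset2X leq_imset_card.
Qed.

Lemma gap_triangle (T : finType) (e : rel T) (u v w : T) :
  (gap e u w <= gap e u v + gap e v w)%N.
Proof.
apply: leq_trans (subset_leq_card _) (leq_card_setU _ _).
by apply/subsetP => x; rewrite !inE; case: (e u x); case: (e v x); rewrite ?andbF ?orbT.
Qed.

(** [Kr_free] speaks of sets of exactly [r] vertices, so a larger clique is first cut down to [r] of
    its vertices. *)
Lemma card_clique_lt (T : finType) (e : rel T) (r : nat) (S : {set T}) :
  Kr_free e r -> is_clique e S -> (#|S| < r)%N.
Proof.
move=> fr /forall_inP cS; rewrite ltnNge; apply/negP => rS.
pose S' := [set x in take r (enum S)].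
have S'S : {subset S' <= S} by move=> x; rewrite inE => /mem_take; rewrite mem_enum.
have S'r : #|S'| = r.
  by rewrite cardsE (card_uniqP _) ?take_uniq ?enum_uniq // size_takel // -cardE.
move/negP: (fr S' S'r); apply; apply/forall_inP => x /S'S xS; apply/forall_inP => y /S'S yS.
by have /forall_inP/(_ y yS) := cS x xS.
Qed.

Theorem theorem1p1 (R : realType) (r : nat) (eps : R) :
  (3 <= r)%N -> 0 < eps ->
  exists C : nat,
    forall (T : finType) (e : rel T),
      symmetric e -> irreflexive e ->
      Kr_free e r ->
      (forall u v : T, u != v -> ~~ e u v ->
         eps * (#|T|%:R) ^+ (r - 2) <=
           (num_Kk_in e (r - 2) (nbhd e u :&: nbhd e v))%:R) ->
      colourable e C.
Proof.
move=> r3 eps_gt0.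
have [k ->] : exists k, r = k.+3 by exists (r - 3)%N; lia.
(* Capping at 1 keeps [1 - eps1] nonnegative. The factor 3 leaves room for two steps of closeness:
   [2 * d < eps1]. *)
pose eps1 := Num.min eps 1; pose d := eps1 / 3%:R.
have e0 : 0 < eps1 by rewrite lt_min eps_gt0 ltr01.
have e1 : eps1 <= 1 by rewrite ge_min lexx orbT.
have e_le : eps1 <= eps by rewrite ge_min lexx.
have d0 : 0 < d by rewrite divr_gt0.
have [m hm] : exists m : nat, (1 - eps1) ^+ m <= d / 2%:R.
  by apply: exists_expr_le; rewrite // divr_gt0.
exists (2 ^ m.+1 + k.+3)%N => T e es ei fr dense.
rewrite [(k.+3 - 2)%N](_ : _ = k.+1) in dense; last by lia.
pose F u := cliques_in e k.+1 (nbhd e u).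
pose V := [set u | [exists v, (u != v) && ~~ e u v]].
pose close u v := ((gap e u v)%:R : R) <= d * #|T|%:R.
have [|A [AV sepA netA]] := @exists_close_net T close V.
  by move=> u; rewrite /close /gap setDv cards0 mulr_ge0 // ltW.
have bigF u v : u \in V -> ~~ e u v -> eps1 * (#|T| ^ k.+1)%:R <= #|F u :&: F v|%:R.
  have bigF' x y : x != y -> ~~ e x y -> eps1 * (#|T| ^ k.+1)%:R <= #|F x :&: F y|%:R.
    move=> xy exy; rewrite cliques_inI; apply: le_trans (dense x y xy exy).
    by rewrite natrX ler_wpM2r // exprn_ge0.
  rewrite inE => /existsP[w /andP[uw euw]] euv.
  have [<-|uv] := eqVneq u v; last exact: bigF'.
  (* The case [v = u] is why [V] asks for a non-neighbour [w]: [F u] contains the large set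
     [F u :&: F w]. *)
  by apply: le_trans (bigF' _ _ uw euw) _; rewrite setIid ler_nat subset_leq_card // subsetIl.
have Fdisj u v : e u v -> F u :&: F v = set0 by apply: cliques_in_adjacent.
have cardA : (#|A| <= 2 ^ m.+1)%N.
  have [->|[a aA]] := set_0Vmem A; first by rewrite cards0.
  pose W := [set S : {set T} | #|S| == k.+1].
  apply: (@card_separated_le R T _ e F W (#|T| ^ k.+1) m eps1 d A) => //.
  - by rewrite -ler_pdivlMr.
  - by rewrite card_draws bin_le_expn.
  - by rewrite expn_gt0; apply/orP; left; apply/card_gt0P; exists a.
  - by move=> u; apply/subsetP => S; rewrite !inE => /and3P[].
  - by move=> u w uA; apply: bigF; apply: (subsetP AV).
have cardU : (#|~: V| < k.+3)%N.
  apply: card_clique_lt fr _; apply/forall_inP => x; rewrite !inE negb_exists => /forallP xU.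
  apply/forall_inP => y _; apply/implyP => xy.
  by have := xU y; rewrite xy negbK.
(* The default [u] of [odflt] is never reached, as the net has a member close to each vertex of
   [V]. *)
pose g u := if u \in V then odflt u [pick a in A | close u a && close a u] else u.
have gP u : u \in V -> [/\ g u \in A, close u (g u) & close (g u) u].
  move=> uV; rewrite /g uV; case: pickP => [a /and3P[]|no] //.
  by have [a aA ua] := netA u uV; have := no a; rewrite /= aA ua.
have gU u : u \notin V -> g u = u by rewrite /g => /negPf->.
apply: (@colourable_by_map T e (A :|: ~: V) g).
- move=> u; rewrite in_setU in_setC; case: (boolP (u \in V)) => uV.
    by have [->] := gP u uV.
  by rewrite gU // uV orbT.
- by apply: leq_trans (leq_card_setU _ _) _; rewrite leq_add // ltnW.
move=> u v euv; apply/eqP => guv.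
(* If only one of [u], [v] is in [V], their images differ: one lies in [A], hence in [V], and the
   other is fixed outside [V]. *)
case: (boolP (u \in V)) => uV; last first.
  case: (boolP (v \in V)) => vV.
    have [] := gP v vV; rewrite -guv gU // => /(subsetP AV) uV'.
    by rewrite uV' in uV.
  by move: guv euv; rewrite !gU // => ->; rewrite ei.
case: (boolP (v \in V)) => vV; last first.
  have [] := gP u uV; rewrite guv gU // => /(subsetP AV) vV'.
  by rewrite vV' in vV.
have [_ ua _] := gP u uV; have [_ _ av] := gP v vV.
rewrite -guv in av; set a := g u in ua av.
have gap_uv : (gap e u v)%:R <= 2%:R * d * #|T|%:R :> R.
  have : (gap e u v)%:R <= (gap e u a)%:R + (gap e a v)%:R :> R.
    by rewrite -natrD ler_nat gap_triangle.
  by move: ua av; rewrite /close; lra.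
have n0 : 0 < #|T|%:R :> R by rewrite ltr0n; apply/card_gt0P; exists u.
(* With n the number of vertices: [eps1] n^(k+1) <= |F(u)| = |F(u) \ F(v)| <= [gap e u v] n^k <=
   [2 * d] n^(k+1), which contradicts [d = eps1 / 3]. *)
have := bigF u u uV; rewrite ei => /(_ isT).
have -> : F u :&: F u = F u :\: F v.
  by rewrite setIid; apply/esym/setDidPl; rewrite -setI_eq0 Fdisj.
move=> /le_trans/(_ (_ : _ <= (gap e u v * #|T| ^ k)%:R)); rewrite ler_nat card_cliques_diff.
move=> /(_ isT); rewrite natrM expnS natrM mulrA ler_pM2r; last by rewrite natrX exprn_gt0.
move=> /le_trans/(_ gap_uv); rewrite ler_pM2r // /d; lra.
Qed.
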